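(* Let $G$ be a graph with a hole cover $\mathcal C$ satisfying the NC property in $G$. If $K\subseteq V(G)$ is a clique in $\widehat G(\mathcal C)$ but not a clique in $G$, then there is a vertex $u\in K\cap\mathcal C$ such that $K\setminus\{u\}$ is a clique in $G$.
   Context: All graphs are finite and simple. A hole of $G$ is an induced cycle of length at least $4$; $\mathcal H(G)$ is the set of holes of $G$ and $\mathcal H(G,u)$ the set of holes containing $u$. A hole cover of $G$ is a nonempty $X\subseteq V(G)$ meeting every hole. A vertex $u$ satisfies the NC property in $G$ if there are no holes $H\in\mathcal H(G,u)$, $H'\in\mathcal H(G)\setminus\mathcal H(G,u)$ sharing two consecutive edges (two distinct edges with a common end vertex lying on both). A set $\mathcal C$ satisfies the NC property in $G$ if each of its vertices does and every hole contains at most one vertex of $\mathcal C$. Locally chordalizing all holes in $\mathcal H(G,u)$ by $u$ means adding all edges $uw$ with $w\ne u$ lying on some hole in $\mathcal H(G,u)$. For a hole cover $\mathcal C=\{u_1,\dots,u_k\}$ satisfying the NC property in $G$, set $G_0=G$, let $G_i$ be obtained from $G_{i-1}$ by locally chordalizing all holes in $\mathcal H(G_{i-1},u_i)$ by $u_i$, and put $\widehat G(\mathcal C)=G_k$ (this graph is chordal and independent of the ordering of $\mathcal C$). *)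

(* Defs.v *)
(* Graphs: a finite vertex type T : finType with a
   Prop-valued adjacency relation (simple: symmetric, irreflexive). *)
From mathcomp Require Import all_boot.
Set Implicit Arguments. Unset Strict Implicit. Unset Printing Implicit Defensive.

Section Holes.
Variable T : finType.
Implicit Types (adj : T -> T -> Prop) (H C K : {set T}).

Definition induced_cycle_seq adj (s : seq T) : Prop :=
  [/\ uniq s, 4 <= size s &
      forall x y, x \in s -> y \in s ->
        (adj x y <-> (y = next s x \/ x = next s y))].

(* A hole (identified with its vertex set; an induced cycle is determined by it). *)
Definition hole adj H : Prop :=
  exists s, induced_cycle_seq adj s /\ H = [set x in s].

Definition hole_cover adj C : Prop :=
  C != set0 /\ forall H, hole adj H -> exists x, x \in C /\ x \in H.

(* NC property of a vertex u: no hole H through u and hole H' avoiding u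
   share two consecutive edges ab, bc (a <> c).  Since holes are induced,
   an edge of G between two vertices of a hole is an edge of that hole. *)
Definition NC_vertex adj (u : T) : Prop :=
  ~ exists H H' (a b c : T),
      [/\ hole adj H, hole adj H', u \in H & u \notin H'] /\
      [/\ a \in H, b \in H & c \in H] /\ [/\ a \in H', b \in H' & c \in H'] /\
      [/\ a <> c, adj a b & adj b c].

Definition NC_set adj C : Prop :=
  (forall u, u \in C -> NC_vertex adj u) /\
  (forall H, hole adj H -> #|H :&: C| <= 1).

Definition local_chordalize adj (u : T) : T -> T -> Prop :=
  fun x y => adj x y
    \/ (x = u /\ y <> u /\ exists H, [/\ hole adj H, u \in H & y \in H])
    \/ (y = u /\ x <> u /\ exists H, [/\ hole adj H, u \in H & x \in H]).

(* \hat G(C) computed along an ordering s of C: G_0 = G, G_i from G_{i-1}. *)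
Definition hatG adj (s : seq T) : T -> T -> Prop :=
  foldl local_chordalize adj s.

Definition clique adj K : Prop :=
  forall x y, x \in K -> y \in K -> x <> y -> adj x y.

End Holes.

(* Main.v *)
Require Import Defs.
From mathcomp Require Import all_boot zify boolp.
Set Implicit Arguments.
Unset Strict Implicit.
Unset Printing Implicit Defensive.

(** A shortest path between two nonadjacent neighbours of [v] that otherwise
    avoids [v] and its neighbours closes up to a hole through [v]. Hence two
    nonadjacent vertices lie on a common hole if and only if they are joined
    through each of two sets with no edge between them.

    Let [H] be a hole through a vertex [u] with the NC property, and [v] a
    vertex of [H] not adjacent to [u]. The two neighbours [a], [b] of [v] on
    [H] cannot be joined off the neighbourhood of [v] without meeting [u],
    since that would give a hole through [a], [v], [b] avoiding [u]. Let [w]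
    be a neighbour of [v] not adjacent to [u] from which a path leads to [u]
    off the neighbourhood of [v]. The component of [(G - N[v]) - u] entered by
    this path is then adjacent to at most one of [a], [b]; this component and
    the arc of [H] starting at the other one show that [u] and [w] lie on a
    common hole. Consequently a hole created by chordalizing at [u] would have
    a chord at [u]: chordalizing only destroys holes, and every new edge of
    the final graph joins a vertex of [C] to another vertex of a hole of [G]
    through it.

    Finally let [u w] and [v w'] be nonadjacent pairs of [K] with [u], [v]
    distinct in [C]. As no hole contains two vertices of [C], [u v] is an
    edge, and [w = w'] or [w w'] is an edge. A common non-neighbour of [u] and
    [v] leads to a hole through both; otherwise [u v w w'] is such a hole. *)

Local Notation edge e := (fun x y => is_true (e x y)).

(** * Listings of a cycle *)

Section CyclicAdjacency.
Variable T : eqType.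
Implicit Types (v x y : T) (p s : seq T).

Definition next_adjacent s : rel T :=
  fun x y => (y == next s x) || (x == next s y).

Lemma next_adjacent_sym s : symmetric (next_adjacent s).
Proof. by move=> x y; rewrite /next_adjacent orbC. Qed.

Lemma next_cons_head v p : next (v :: p) v = nth v p 0.
Proof. by rewrite next_nth mem_head /= eqxx. Qed.

Lemma next_cons_nth v p i : uniq (v :: p) -> i < size p ->
  next (v :: p) (nth v p i) = nth v p i.+1.
Proof.
case/andP=> vp up li; rewrite next_nth inE mem_nth // orbT /=.
by rewrite ifN ?index_uniq //; apply: contraNneq vp => ->; apply: mem_nth.
Qed.

Variables (v : T) (p : seq T).
Hypotheses (vp_uniq : uniq (v :: p)) (size_p_gt2 : 2 < size p).

Let v_neq_nth i : i < size p -> (v == nth v p i) = false.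
Proof.
move=> li; have /andP[vp _] := vp_uniq.
by apply: contraNF vp => /eqP->; apply: mem_nth.
Qed.

Let p_gt0 : 0 < size p.
Proof. exact: ltn_trans size_p_gt2. Qed.

Lemma next_adjacent_head : next_adjacent (v :: p) v v = false.
Proof. by rewrite /next_adjacent next_cons_head v_neq_nth. Qed.

Lemma next_adjacent_head_nth i : i < size p ->
  next_adjacent (v :: p) v (nth v p i) = (i == 0) || (i.+1 == size p).
Proof.
move=> li; have /andP[_ up] := vp_uniq.
rewrite /next_adjacent next_cons_head next_cons_nth // nth_uniq //.
congr (_ || _).
case: (ltnP i.+1 (size p)) => lip; first by rewrite v_neq_nth // ltn_eqF.
by rewrite nth_default // eqxx eqn_leq li lip.
Qed.

Lemma next_adjacent_nth i j : i < size p -> j < size p ->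
  next_adjacent (v :: p) (nth v p i) (nth v p j) = (j == i.+1) || (i == j.+1).
Proof.
move=> li lj; have /andP[_ up] := vp_uniq.
have nth_succ k l : k < size p -> l < size p ->
    (nth v p k == nth v p l.+1) = (k == l.+1).
  move=> lk ll; case: (ltnP l.+1 (size p)) => lp; first by rewrite nth_uniq.
  rewrite [nth v p l.+1]nth_default // eq_sym v_neq_nth // ltn_eqF //.
  exact: leq_trans lk _.
by rewrite /next_adjacent !next_cons_nth // !nth_succ.
Qed.

End CyclicAdjacency.

(** * Connectivity in induced subgraphs *)

Section Graph.
Variables (T : finType) (e : rel T).
Implicit Types (x y z : T) (A B D : {set T}).

Definition restrict A : rel T := [rel x y | [&& x \in A, y \in A & e x y]].

Definition connect_in A : rel T := connect (restrict A).

Definition connected A := {in A &, forall x y, connect_in A x y}.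

Definition nonnbrs x := [set y | (y != x) && ~~ e x y].

Definition attached x A := [exists y in A, e x y].

Definition anticomplete A B := {in A & B, forall x y, y \in nonnbrs x}.

Lemma attachedP x A : reflect (exists2 y, y \in A & e x y) (attached x A).
Proof. exact: exists_inP. Qed.

Lemma connect_in_refl A : reflexive (connect_in A).
Proof. exact: connect0. Qed.

Lemma connect_in_trans A : transitive (connect_in A).
Proof. exact: connect_trans. Qed.

Lemma connect_in_edge A x y : x \in A -> y \in A -> e x y -> connect_in A x y.
Proof. by move=> xA yA exy; apply: connect1; apply/and3P. Qed.

Lemma connect_inS A B x y : A \subset B -> connect_in A x y -> connect_in B x y.
Proof.
move/subsetP=> sAB; apply: connect_sub => z t /and3P[/sAB zB /sAB tB].
exact: connect_in_edge.
Qed.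

Lemma connect_in_mem A x y :
  connect_in A x y -> (x == y) || (x \in A) && (y \in A).
Proof.
case/connectP=> p; elim: p x => [|z p IH] x /= => [_ ->|].
  by rewrite eqxx.
case/andP=> /and3P[-> zA _] zp yp.
by case/orP: (IH z zp yp) => [/eqP <-|/andP[_ ->]]; rewrite ?zA orbT.
Qed.

Lemma connect_in_exit A D x y : connect_in A x y -> x \in D -> y \notin D ->
  exists a b,
    [/\ a \in A :&: D, b \in A :\: D, e a b & connect_in (A :&: D) x a].
Proof.
case/connectP=> p; elim: p x => [|z p IH] x /=; first by move=> _ -> ->.
case/andP=> /and3P[xA zA exz] zp yp xD yD.
case: (boolP (z \in D)) => [zD|zD]; last first.
  by exists x, z; split; rewrite ?inE ?xA ?zD //; apply: connect_in_refl.
have [a [b [aD bAD eab cza]]] := IH z zp yp zD yD.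
exists a, b; split=> //; apply: connect_in_trans cza.
by apply: connect_in_edge; rewrite ?inE ?xA ?zA.
Qed.

Hypothesis e_sym : symmetric e.

Lemma connect_in_sym A : symmetric (connect_in A).
Proof.
by move=> x y; apply: sym_connect_sym => z t; rewrite /restrict /= e_sym andbCA.
Qed.

Lemma nonnbrs_sym x y : (x \in nonnbrs y) = (y \in nonnbrs x).
Proof. by rewrite !inE eq_sym e_sym. Qed.

Lemma anticomplete_sym A B : anticomplete A B -> anticomplete B A.
Proof. by move=> AB x y xB yA; rewrite nonnbrs_sym AB. Qed.

Lemma anticomplete_notin A B x : anticomplete A B -> x \in A -> x \notin B.
Proof. by move=> AB xA; apply/negP => /(AB x x xA); rewrite inE eqxx. Qed.

Lemma anticomplete_not_attached A B x :
  anticomplete A B -> x \in A -> ~~ attached x B.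
Proof.
move=> AB xA; apply/negP => /attachedP[y yB exy].
by have := AB x y xA yB; rewrite inE exy andbF.
Qed.

Lemma sorted_connected s : sorted e s -> connected [set x in s].
Proof.
case: s => [|x p] xp; first by move=> y; rewrite inE.
set A := [set _ in _].
have cx y : y \in A -> connect_in A x y.
  rewrite inE; apply: path_connect; move: xp.
  apply: (@sub_in_path _ [in A]) => [z t zA tA ezt|].
    exact/and3P.
  by apply/allP => z; rewrite !inE.
by move=> y z /cx + /cx; rewrite connect_in_sym; apply: connect_in_trans.
Qed.

Definition component A x := [set y | connect_in A x y].

Lemma component_sub A x : x \in A -> component A x \subset A.
Proof.
move=> xA; apply/subsetP => y; rewrite inE => /connect_in_mem.
by case/orP=> [/eqP <-|/andP[]].
Qed.

Lemma component_closed A x y z : x \in A -> y \in component A x ->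
  z \in A -> e y z -> z \in component A x.
Proof.
move=> xA yC zA eyz; have yA := subsetP (component_sub xA) _ yC.
move: yC; rewrite !inE => cxy; apply: connect_in_trans cxy _.
exact: connect_in_edge.
Qed.

Lemma component_connected A x : x \in A -> connected (component A x).
Proof.
move=> xA; set C := component A x.
suff cx y : y \in C -> connect_in C x y.
  by move=> y z /cx + /cx; rewrite connect_in_sym; apply: connect_in_trans.
rewrite inE => cxy; apply: contraT => nxy.
have [||a [b []]] := @connect_in_exit A (component C x) x y cxy.
- by rewrite inE connect_in_refl.
- by rewrite inE.
rewrite !inE => /andP[aA cxa] /andP[nxb bA] eab _; case/negP: nxb.
have aC : a \in C.
  by rewrite inE; apply: connect_inS cxa; apply: component_sub.
apply: connect_in_trans cxa _; apply: connect_in_edge => //.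
exact: component_closed aC bA eab.
Qed.

Lemma connect_in_first_nbr A x y : connect_in A y x -> y \in nonnbrs x ->
  exists a, [/\ a \in A, e x a & connect_in (a |: A :&: nonnbrs x) y a].
Proof.
move=> cyx ynx; have [|a [b [aAx bAx eab cya]]] := connect_in_exit cyx ynx.
  by rewrite inE eqxx.
have exb : e x b.
  move: bAx aAx; rewrite !inE negb_and !negbK.
  case/andP=> /orP[/eqP <-|//] _ /and3P[_ _].
  by rewrite e_sym eab.
exists b; split=> //; first by case/setDP: bAx.
apply: (@connect_in_trans _ a); first exact: connect_inS (subsetUr _ _) cya.
by apply: connect_in_edge; rewrite ?setU11 // setU1r.
Qed.

Hypothesis e_irr : irreflexive e.

Lemma connect_in_first_nbr_via D x y :
  y \in nonnbrs x -> connect_in (x |: (y |: D)) y x ->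
  exists a,
    [/\ a \in D, e x a & connect_in (a |: (y |: D :&: nonnbrs x)) y a].
Proof.
move=> ynx cyx; have [a [aD exa cya]] := connect_in_first_nbr cyx ynx.
exists a; split=> //.
  move: aD exa; rewrite !inE => /or3P[/eqP->|/eqP->|//]; first by rewrite e_irr.
  by move: ynx; rewrite inE => /andP[_ /negbTE->].
apply: connect_inS cya; apply/setUS/subsetP => z.
rewrite !inE => /andP[+ /andP[zx nxz]]; rewrite (negbTE zx) nxz /=.
by rewrite andbT.
Qed.

Fixpoint induced_path x (p : seq T) : bool :=
  if p is y :: q then
    [&& e x y, all [in nonnbrs x] q & induced_path y q]
  else true.

Lemma induced_path_path x p : induced_path x p -> path e x p.
Proof. by elim: p x => //= y p IH x /and3P[-> _ /IH]. Qed.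

Lemma induced_path_uniq x p : induced_path x p -> uniq (x :: p).
Proof.
elim: p x => // y p IH x /and3P[exy /allP xp /IH yp].
rewrite cons_uniq yp andbT inE negb_or.
rewrite (contraTneq _ exy) => [|->]; last by rewrite e_irr.
by apply/negP => /xp; rewrite inE eqxx.
Qed.

Lemma induced_path_nth x0 x p i j : induced_path x p -> i < j <= size p ->
  e (nth x0 (x :: p) i) (nth x0 (x :: p) j) = (j == i.+1).
Proof.
elim: p x i j => [|y p IH] x i [|j] ip /andP[lij ljp] //.
case/and3P: ip => exy /allP xp yp; case: i lij => [|i] lij.
  case: j lij ljp => [|j] _ //= ljp.
  by have := xp _ (mem_nth x0 ljp); rewrite inE => /andP[_ /negbTE].
by apply: IH yp _; apply/andP.
Qed.

Lemma connect_in_induced_path A x y : connect_in A x y ->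
  exists p, [/\ induced_path x p, last x p = y & {subset p <= A}].
Proof.
have [n] := ubnP #|A|; elim: n => // n IH in A x *; rewrite ltnS => leAn cxy.
case: (eqVneq x y) => [<-|xy]; first by exists [::].
have /andP[xA yA] : (x \in A) && (y \in A).
  by have := connect_in_mem cxy; rewrite (negbTE xy).
case: (boolP (y \in nonnbrs x)) => [ynx|]; last first.
  rewrite inE eq_sym xy negbK => exy; exists [:: y]; split=> //=.
    by rewrite exy.
  by move=> z /[1!inE] /eqP->.
rewrite connect_in_sym in cxy.
have [a [aA exa cya]] := connect_in_first_nbr cxy ynx.
have sA : a |: A :&: nonnbrs x \subset A :\ x.
  apply/subsetP => z; rewrite !inE => /orP[/eqP->|/and3P[-> -> //]].
  by rewrite aA andbT; apply: contraTneq exa => ->; rewrite e_irr.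
have [||p [ap lp pA]] := IH (a |: A :&: nonnbrs x) a; last 1 first.
- exists (a :: p); split=> //=.
    rewrite exa ap andbT; apply/allP => z zp; have := pA z zp.
    rewrite 2!inE => /orP[/eqP za|/setIP[] //].
    by have /andP[] := induced_path_uniq ap; rewrite -za zp.
  move=> z /[1!inE] /orP[/eqP->//|/pA/(subsetP sA)]; by case/setD1P.
- apply: leq_trans leAn; apply: leq_ltn_trans (subset_leq_card sA) _.
  by rewrite [ltnRHS](cardsD1 x) xA.
- by rewrite connect_in_sym.
Qed.

(** * Holes *)

Definition induced_cycle_at v (p : seq T) : Prop :=
  [/\ uniq (v :: p), 2 < size p,
      forall i, i < size p -> e v (nth v p i) = (i == 0) || (i.+1 == size p) &
      forall i j, i < size p -> j < size p ->
        e (nth v p i) (nth v p j) = (j == i.+1) || (i == j.+1)].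

Lemma induced_cycle_next_adjacent s : uniq s -> 4 <= size s ->
  induced_cycle_seq (edge e) s <-> {in s &, e =2 next_adjacent s}.
Proof.
move=> us s4; split=> [[_ _ adj_s] x y xs ys | adj_s].
  apply/idP/orP => [/(adj_s x y xs ys)[]->|]; rewrite ?eqxx; auto.
  by case=> /eqP next_xy; apply/(adj_s x y xs ys); auto.
split=> // x y xs ys; rewrite adj_s //; split=> [/orP[]/eqP|]; auto.
by case=> next_xy; apply/orP; rewrite -next_xy eqxx; auto.
Qed.

Lemma induced_cycle_cons v p :
  induced_cycle_seq (edge e) (v :: p) <-> induced_cycle_at v p.
Proof.
split=> [cvp|[us p3 ev ep]].
  have [us p3 _] := cvp; move/(induced_cycle_next_adjacent us p3): cvp => adj.
  split=> // [i li|i j li lj].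
    by rewrite adj ?mem_head ?next_adjacent_head_nth // inE mem_nth ?orbT.
  by rewrite adj ?next_adjacent_nth // inE mem_nth ?orbT.
apply/induced_cycle_next_adjacent=> // x y.
rewrite !inE => /orP[/eqP->|/(nthP v)[i li <-]] /orP[/eqP->|/(nthP v)[j lj <-]].
- by rewrite e_irr next_adjacent_head.
- by rewrite ev // next_adjacent_head_nth.
- by rewrite e_sym ev // next_adjacent_sym next_adjacent_head_nth.
- by rewrite ep // next_adjacent_nth.
Qed.

Lemma hole_induced_cycle_at v H : hole (edge e) H -> v \in H ->
  exists p, H = [set x in v :: p] /\ induced_cycle_at v p.
Proof.
case=> s [[us s4 adjs] ->]; rewrite inE => /rot_to[i p rot_s].
have mem_s x : (x \in s) = (x \in v :: p) by rewrite -rot_s mem_rot.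
exists p; split; first by apply/setP => x; rewrite !inE mem_s inE.
apply/induced_cycle_cons; split; rewrite -rot_s ?rot_uniq ?size_rot //.
by move=> x y; rewrite !mem_rot !next_rot //; apply: adjs.
Qed.

Lemma induced_path_cycle v a p : induced_path a p -> 1 < size p ->
  e v a -> e v (last a p) ->
  {subset a :: p <= [set a; last a p] :|: nonnbrs v} ->
  induced_cycle_at v (a :: p).
Proof.
move=> ap p2 eva evb apN; have uap := induced_path_uniq ap.
have nth_p : nth v (a :: p) (size p) = last a p := nth_last v (a :: p).
split=> //.
- rewrite cons_uniq uap andbT; apply/negP => /apN; rewrite !inE eqxx orbF.
  by case/orP=> /eqP vE; [move: eva | move: evb]; rewrite -vE e_irr.
- move=> i li; apply/idP/orP => [evi|[]/eqP]; last 2 first.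
  + by move=> ->.
  + by move=> [->]; rewrite nth_p.
  have := apN _ (mem_nth v li); rewrite !inE evi andbF orbF -nth_p.
  rewrite -[X in _ == X]/(nth v (a :: p) 0) !nth_uniq //.
  by case/orP; [left | right].
- have lt_nth i j : i < j < size (a :: p) ->
      e (nth v (a :: p) i) (nth v (a :: p) j) = (j == i.+1) || (i == j.+1).
    case/andP=> lij ljp; rewrite (induced_path_nth _ ap) ?lij //.
    by rewrite [i == _]ltn_eqF ?orbF // ltnS ltnW.
  move=> i j li lj; case: (ltngtP i j) => [lij|lji|->].
  + by rewrite lt_nth ?lij.
  + by rewrite e_sym lt_nth ?lji // orbC.
  + by rewrite e_irr [j == _]ltn_eqF.
Qed.

Lemma hole_closing_path A v a b : connect_in A a b -> e v a -> e v b ->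
  b \in nonnbrs a -> A \subset [set a; b] :|: nonnbrs v ->
  exists X, [/\ hole (edge e) X, [/\ a \in X, v \in X & b \in X],
    X :\ v \subset A & connect_in (X :\ v) a b].
Proof.
move=> cab eva evb; rewrite inE => /andP[ba nab] /subsetP sA.
have aA : a \in A.
  by have := connect_in_mem cab; rewrite eq_sym (negbTE ba) => /andP[].
have [p [ap lp pA]] := connect_in_induced_path cab.
have apA x : x \in a :: p -> x \in A by rewrite inE => /orP[/eqP->|/pA].
have p2 : 1 < size p.
  case: p lp ap {pA apA} => [|x [|//]] /= xb; first by rewrite xb eqxx in ba.
  by rewrite xb (negbTE nab).
have cyc : induced_cycle_at v (a :: p).
  by apply: induced_path_cycle; rewrite ?lp // => x /apA/sA.
have Xv : [set x in v :: a :: p] :\ v = [set x in a :: p].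
  by rewrite set_cons setU1K // inE; case: cyc => /andP[].
exists [set x in v :: a :: p]; rewrite Xv; split.
- by exists (v :: a :: p); split=> //; apply/induced_cycle_cons.
- by split; rewrite inE ?mem_head // in_cons -?lp ?mem_head ?mem_last orbT.
- by apply/subsetP => x; rewrite inE => /apA.
- apply: (@sorted_connected (a :: p)); first exact: induced_path_path.
    by rewrite inE mem_head.
  by rewrite inE -lp mem_last.
Qed.

Definition arc z u a A : Prop :=
  [/\ connected A, a \in A, {in A, forall x, e z x = (x == a)} & attached u A].

Lemma induced_cycle_at_rev v p :
  induced_cycle_at v p -> induced_cycle_at v (rev p).
Proof.
case=> us p3 ev ep; split; rewrite ?size_rev //.
- by rewrite cons_uniq mem_rev rev_uniq.
- by move=> i li; rewrite nth_rev // ev; lia.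
- by move=> i j li lj; rewrite !nth_rev // ep; lia.
Qed.

Lemma induced_cycle_arc v p u q : induced_cycle_at v (p ++ u :: q) ->
  0 < size p -> 0 < size q -> arc v u (nth v p 0) [set x in p].
Proof.
case=> /[!cons_uniq] /andP[_ upq] _ ev ep p0 q0.
rewrite size_cat /= in ev ep.
have nthp i : i < size p -> nth v (p ++ u :: q) i = nth v p i.
  by move=> li; rewrite nth_cat li.
have up : uniq p by move: upq; rewrite cat_uniq => /andP[].
split.
- apply: sorted_connected; apply/(sortedP v) => i li.
  by rewrite -!nthp ?(ltnW li) // ep ?eqxx // ltn_addr // ltnW.
- by rewrite inE mem_nth.
- move=> x; rewrite inE => /(nthP v)[i li <-].
  rewrite nth_uniq // -nthp // ev ?ltn_addr // addnS eqSS.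
  by rewrite [i == _ + _]ltn_eqF ?orbF // ltn_addr.
- have last_lt : (size p).-1 < size p by rewrite prednK.
  have size_lt : size p < size p + (size q).+1 by rewrite -addSnnS leq_addr.
  apply/attachedP; exists (nth v p (size p).-1); first by rewrite inE mem_nth.
  have <- : nth v (p ++ u :: q) (size p) = u by rewrite nth_cat ltnn subnn.
  by rewrite -nthp // ep // ?ltn_addr // prednK ?eqxx ?orbT.
Qed.

Lemma induced_cycle_anticomplete v p u q : induced_cycle_at v (p ++ u :: q) ->
  anticomplete [set x in p] [set x in q].
Proof.
case=> /[!cons_uniq] /andP[_ upq] _ _ ep x y; rewrite !inE => xp yq.
apply/andP; split.
  move: upq; rewrite cat_uniq /= => /and4P[_ /norP[_ /hasPn qp] _ _].
  by apply: contraTneq yq => ->; apply: contraL xp => /qp.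
case/(nthP v): xp => i li <-; case/(nthP v): yq => j lj <-.
have nth_p : nth v (p ++ u :: q) i = nth v p i by rewrite nth_cat li.
have nth_q : nth v (p ++ u :: q) (size p + j.+1) = nth v q j.
  by rewrite nth_cat ltnNge leq_addr /= addKn.
rewrite -nth_p -nth_q ep ?size_cat ?ltn_add2l ?ltn_addr //=.
by rewrite addnS eqSS gtn_eqF ?ltn_eqF ?ltn_addr // !leqW ?ltn_addr.
Qed.

Lemma hole_arcs H z u :
  hole (edge e) H -> z \in H -> u \in H -> u \in nonnbrs z ->
  exists A B a b, [/\ A :|: B = H :\: [set z; u], anticomplete A B,
    arc z u a A & arc z u b B].
Proof.
move=> hH zH uH; rewrite inE => /andP[uz nzu].
have [p [HE cyc]] := hole_induced_cycle_at hH zH.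
have up : u \in p by move: uH; rewrite HE !inE (negbTE uz).
move: HE cyc; case/splitPr: p / up => p q HE cyc.
have [/[!cons_uniq]/andP[zpq upq] _ ev _] := cyc.
have p0 : 0 < size p.
  by case: p {HE upq zpq cyc} ev => // ev; rewrite (ev 0) in nzu.
have q0 : 0 < size q.
  case: q {HE upq zpq cyc} ev => // ev; have := ev (size p).
  rewrite size_cat addn1 ltnSn eqxx orbT nth_cat ltnn subnn /= (negbTE nzu).
  by move/(_ isT).
have cycR : induced_cycle_at z (rev q ++ u :: rev p).
  by rewrite -cat_rcons -rev_cons -rev_cat; apply: induced_cycle_at_rev.
exists [set x in p], [set x in q], (nth z p 0), (nth z (rev q) 0); split.
- apply/setP => x; rewrite HE !inE mem_cat inE.
  move: zpq upq; rewrite mem_cat inE cat_uniq /= !negb_or.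
  case: (eqVneq x z) => [->|_] /=; first by case/and3P=> /negbTE-> _ /negbTE->.
  case: (eqVneq x u) => [->|_] //= _.
  by case/and4P=> _ /andP[/negbTE-> _] /negbTE->.
- exact: induced_cycle_anticomplete cyc.
- exact: induced_cycle_arc cyc p0 q0.
- have -> : [set x in q] = [set x in rev q].
    by apply/setP => x; rewrite !inE mem_rev.
  by apply: induced_cycle_arc cycR _ _; rewrite size_rev.
Qed.

Lemma hole_nbrs H v : hole (edge e) H -> v \in H ->
  exists a b, [/\ a \in H, b \in H, b \in nonnbrs a &
    {in H, forall x, e v x = (x == a) || (x == b)}].
Proof.
move=> hH vH; have [p [-> []]] := hole_induced_cycle_at hH vH.
rewrite cons_uniq => /andP[vp up] p3 ev ep.
have p0 : 0 < size p by apply: ltn_trans p3.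
have last_lt : (size p).-1 < size p by rewrite prednK.
have last_gt1 : 1 < (size p).-1 by rewrite -ltnS prednK.
exists (nth v p 0), (nth v p (size p).-1); split.
- by rewrite !inE mem_nth ?orbT.
- by rewrite !inE mem_nth ?orbT.
- by rewrite inE nth_uniq // ep // (gtn_eqF last_gt1) gtn_eqF // ltnW.
- move=> x; rewrite !inE => /orP[/eqP->|/(nthP v)[i li <-]]; last first.
    by rewrite ev // !nth_uniq // -[_ == (size p).-1]eqSS prednK.
  rewrite e_irr; apply/esym/norP.
  by split; apply: contraNN vp => /eqP->; apply: mem_nth.
Qed.

Lemma hole_of_anticomplete A B x y : y \in nonnbrs x -> x \notin A :|: B ->
  y \notin A :|: B -> anticomplete A B ->
  connect_in (x |: (y |: A)) y x -> connect_in (x |: (y |: B)) y x ->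
  exists X, [/\ hole (edge e) X, x \in X & y \in X].
Proof.
move=> ynx; rewrite !in_setU !negb_or => /andP[xA xB] /andP[yA yB] AB.
move=> /(connect_in_first_nbr_via ynx)[a [aA exa cya]].
move=> /(connect_in_first_nbr_via ynx)[b [bB exb cyb]].
pose P := [set a; b] :|: (y |: (A :|: B) :&: nonnbrs x).
have sP : P \subset [set a; b] :|: nonnbrs x.
  by apply: setUS; rewrite subUset sub1set ynx subsetIr.
have cabP : connect_in P a b.
  apply: (@connect_in_trans _ y).
    rewrite connect_in_sym; apply: connect_inS cya.
    apply/subsetP => z; rewrite !inE.
    by case/or3P=> [->|->|/andP[-> ->]]; rewrite ?orbT.
  apply: connect_inS cyb; apply/subsetP => z; rewrite !inE.
  by case/or3P=> [->|->|/andP[-> ->]]; rewrite ?orbT.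
have bna : b \in nonnbrs a := AB a b aA bB.
have [X [hX [_ xX _] /subsetP XP cab]] := hole_closing_path cabP exa exb bna sP.
exists X; split=> //; apply: contraT => yX.
have bA : b \notin A := anticomplete_notin (anticomplete_sym AB) bB.
have [c [d [/setIP[_ cA] /setDP[dX dA] ecd _]]] := connect_in_exit cab aA bA.
suff dB : d \in B by have := AB _ _ cA dB; rewrite inE ecd andbF.
have /setD1P[_ dX'] := dX; move: (XP d dX); rewrite !inE (negbTE dA) /=.
case/or3P=> [/orP[]/eqP dE|/eqP dy|/andP[]//]; first by rewrite dE aA in dA.
  by rewrite dE.
by rewrite -dy dX' in yX.
Qed.

Lemma arc_connect_in v u a A : arc v u a A -> connect_in (v |: (u |: A)) v u.
Proof.
case=> cA aA evA /attachedP[b bA eub].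
have sA : A \subset v |: (u |: A) by rewrite setUA subsetUr.
apply: (@connect_in_trans _ a).
  by apply: connect_in_edge; rewrite ?setU11 ?setU1r ?evA.
apply: (@connect_in_trans _ b); first exact: connect_inS sA (cA a b aA bA).
by apply: connect_in_edge; [rewrite !setU1r | rewrite setU1r ?setU11 |
  rewrite e_sym].
Qed.

Lemma component_anticomplete_arc v u c b B : c \in nonnbrs v :\ u ->
  arc v u b B -> v \notin B -> u \notin B ->
  ~~ attached b (component (nonnbrs v :\ u) c) ->
  anticomplete (component (nonnbrs v :\ u) c) (v |: B).
Proof.
set R := component _ c => cN [cB bB evB _] vB uB nbR.
have sR : {subset R <= nonnbrs v :\ u} := subsetP (component_sub cN).
have BR x y : x \in B -> y \in R -> e y x -> x \in R.
  move=> xB yR eyx; apply: (component_closed cN yR _ eyx).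
  rewrite !inE evB // (memPn uB) // (memPn vB) //=.
  by apply: contraNneq nbR => <-; apply/attachedP; exists y; rewrite // e_sym.
have bR : b \notin R.
  by apply/negP => /sR; rewrite !inE evB // eqxx !andbF.
have BnR x : x \in B -> x \notin R.
  move=> xB; apply/negP => xR.
  have [y [y' [/setIP[_ yR] /setDP[y'B y'R] eyy' _]]] :=
    connect_in_exit (cB x b xB bB) xR bR.
  by case/negP: y'R; apply: BR eyy'.
move=> r x rR /setU1P[->|xB].
  by rewrite nonnbrs_sym; case/setD1P: (sR r rR).
rewrite inE; apply/andP; split; first by apply: contraNneq (BnR x xB) => ->.
by apply: contra (BnR x xB); apply: BR.
Qed.

(* The two sides of the hole are [R] and the path [v] followed by [D]. *)
Lemma hole_of_arc_component u v w c d D (R := component (nonnbrs v :\ u) c) :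
  u \in nonnbrs v -> w \in nonnbrs u -> e v w -> e w c ->
  c \in nonnbrs v :\ u -> attached u R ->
  arc v u d D -> v \notin D -> u \notin D -> ~~ attached d R ->
  exists X, [/\ hole (edge e) X, u \in X & w \in X].
Proof.
move=> unv wnu evw ewc cN /attachedP[r rR eur] arcD vD uD ndR.
have sR : {subset R <= nonnbrs v :\ u} := subsetP (component_sub cN).
have cR : c \in R by rewrite inE connect_in_refl.
have [_ _ evD _] := arcD.
apply: (@hole_of_anticomplete R (v |: D) u w) => //.
- rewrite in_setU in_setU1; apply/norP; split.
    by apply/negP => /sR; rewrite !inE eqxx.
  by rewrite (negbTE uD) orbF; move: unv; rewrite inE => /andP[].
- rewrite in_setU in_setU1; apply/norP; split.
    by apply/negP => /sR; rewrite !inE evw !andbF.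
  apply/norP; split; first by apply: contraTneq evw => ->; rewrite e_irr.
  apply: contra ndR => wD; have := evD w wD; rewrite evw => /esym/eqP <-.
  by apply/attachedP; exists c.
- exact: component_anticomplete_arc ndR.
- apply: (@connect_in_trans _ c).
    by apply: connect_in_edge; rewrite // !inE ?eqxx ?connect_in_refl ?orbT.
  apply: (@connect_in_trans _ r); last first.
    by apply: connect_in_edge; rewrite ?setU11 ?setU1r // e_sym.
  apply: (@connect_inS R); first by rewrite setUA subsetUr.
  exact: component_connected.
- apply: (@connect_in_trans _ v).
    by apply: connect_in_edge; rewrite ?inE ?eqxx ?orbT // e_sym.
  apply: connect_inS (arc_connect_in arcD).
  by apply/subsetP => x; rewrite !inE => /or3P[]->; rewrite ?orbT.
Qed.

(** * Holes through a vertex with the NC property *)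

Section NCVertex.
Variables (u : T) (H : {set T}).
Hypotheses (ncu : NC_vertex (edge e) u) (hH : hole (edge e) H) (uH : u \in H).

Lemma NC_common_path_mem X a v b : hole (edge e) X ->
  [/\ a \in H, v \in H & b \in H] -> [/\ a \in X, v \in X & b \in X] ->
  b \in nonnbrs a -> e v a -> e v b -> u \in X.
Proof.
move=> hX mH mX bna eva evb; apply: contraT => uX; case: ncu.
exists H, X, a, v, b; do !split=> //; last by rewrite e_sym.
by move=> ab; move: bna; rewrite ab inE eqxx.
Qed.

Lemma NC_closing_path_mem v a b P : [/\ a \in H, v \in H & b \in H] ->
  connect_in P a b -> e v a -> e v b -> b \in nonnbrs a ->
  P \subset [set a; b] :|: nonnbrs v -> u \in v |: P.
Proof.
move=> mH cab eva evb bna sP.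
have [X [hX mX /subsetP XP _]] := hole_closing_path cab eva evb bna sP.
have uX := NC_common_path_mem hX mH mX bna eva evb.
by rewrite in_setU1; case: (eqVneq u v) => //= uv; apply: XP; rewrite !inE uv.
Qed.

(* Otherwise [t] joins [a] to [b] off the other neighbours of [z], which closes
   up to a hole through [a], [z], [b] avoiding [u]. *)
Lemma NC_arcs_not_both_attached z t A B a b :
  z \in H -> u \in nonnbrs z -> t \in nonnbrs z -> t != u ->
  A :|: B = H :\: [set z; u] -> anticomplete A B ->
  arc z u a A -> arc z u b B -> attached t A -> ~~ attached t B.
Proof.
move=> zH unz tnz tu AB ant [cA aA ezA _] [cB bB ezB _] /attachedP[x xA etx].
apply/negP => /attachedP[y yB ety].
have sH : {subset A :|: B <= H :\: [set z; u]} by rewrite AB.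
have sP : t |: (A :|: B) \subset [set a; b] :|: nonnbrs z.
  apply/subsetP => p /setU1P[->|pAB]; first by rewrite setUC inE tnz.
  have pz : p != z by apply: contraTneq (sH p pAB) => ->; rewrite !inE eqxx.
  rewrite !inE pz /=; case/setUP: pAB => [/ezA|/ezB] ->.
    by rewrite orbAC orbN.
  by rewrite -orbA orbN orbT.
have cab : connect_in (t |: (A :|: B)) a b.
  apply: (@connect_in_trans _ x).
    by apply: connect_inS (cA a x aA xA); rewrite setUCA subsetUl.
  apply: (@connect_in_trans _ t).
    by apply: connect_in_edge; rewrite 1?e_sym // !inE ?eqxx ?xA ?orbT.
  apply: (@connect_in_trans _ y).
    by apply: connect_in_edge; rewrite // !inE ?eqxx ?yB ?orbT.
  by apply: connect_inS (cB y b yB bB); rewrite setUA subsetUr.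
have eza : e z a by rewrite ezA.
have ezb : e z b by rewrite ezB.
have mH : [/\ a \in H, z \in H & b \in H].
  by split=> //; apply: (subsetP (subsetDl H [set z; u]));
    rewrite -AB inE ?aA ?bB ?orbT.
have := NC_closing_path_mem mH cab eza ezb (ant a b aA bB) sP.
rewrite in_setU1 in_setU1 => /or3P[/eqP uz|/eqP ut|/sH].
- by move: unz; rewrite uz inE eqxx.
- by rewrite ut eqxx in tu.
- by rewrite !inE eqxx orbT.
Qed.

Lemma NC_connect_in_nonnbrs z t : z \in H -> u \in nonnbrs z ->
  t \in nonnbrs z -> t != u -> connect_in (u |: nonnbrs t) z u.
Proof.
move=> zH unz tnz tu.
have [A [B [a [b [AB ant arcA arcB]]]]] := hole_arcs hH zH uH unz.
have connect_along c D : arc z u c D -> t \notin D -> ~~ attached t D ->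
    connect_in (u |: nonnbrs t) z u.
  move=> /arc_connect_in czu tD ntD; apply: connect_inS czu.
  rewrite !subUset !sub1set setU11 setU1r ?(nonnbrs_sym z) //=.
  apply: subsetU; apply/orP; right; apply/subsetP => x xD.
  rewrite inE (memPn tD) //; apply: contra ntD => etx.
  by apply/attachedP; exists x.
case: (boolP (t \in A)) => [tA|tA].
  apply: (connect_along _ _ arcB); first exact: anticomplete_notin ant tA.
  exact: anticomplete_not_attached ant tA.
case: (boolP (t \in B)) => [tB|tB].
  apply: (connect_along _ _ arcA tA).
  exact: anticomplete_not_attached (anticomplete_sym ant) tB.
case: (boolP (attached t A)) => [attA|]; last exact: connect_along arcA tA.
apply: (connect_along _ _ arcB tB).
exact: NC_arcs_not_both_attached zH unz tnz tu AB ant arcA arcB attA.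
Qed.

Lemma NC_component_not_both_attached v c a b
    (R := component (nonnbrs v :\ u) c) :
  [/\ a \in H, v \in H & b \in H] -> e v a -> e v b -> b \in nonnbrs a ->
  u \in nonnbrs v -> c \in nonnbrs v :\ u ->
  attached a R -> ~~ attached b R.
Proof.
move=> mH eva evb bna unv cN /attachedP[x xR eax].
apply/negP => /attachedP[y yR eby].
have sR : {subset R <= nonnbrs v :\ u} := subsetP (component_sub cN).
have cab : connect_in ([set a; b] :|: R) a b.
  apply: (@connect_in_trans _ x).
    by apply: connect_in_edge; rewrite // in_setU ?xR ?set21 ?orbT.
  apply: (@connect_in_trans _ y); last first.
    by apply: connect_in_edge; rewrite 1?e_sym // in_setU ?yR ?set22 ?orbT.
  apply: (@connect_inS R); first exact: subsetUr.
  exact: component_connected.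
have sP : [set a; b] :|: R \subset [set a; b] :|: nonnbrs v.
  by apply/setUS/subsetP => z /sR /setD1P[].
have := NC_closing_path_mem mH cab eva evb bna sP.
rewrite in_setU1 in_setU in_set2 => /or3P[/eqP uv|/orP[]/eqP uE|/sR].
- by move: unv; rewrite uv inE eqxx.
- by move: unv; rewrite uE inE eva andbF.
- by move: unv; rewrite uE inE evb andbF.
- by rewrite in_setD1 eqxx.
Qed.

Lemma NC_hole_through_nbr v w c :
  v \in H -> u \in nonnbrs v -> e v w -> w \in nonnbrs u ->
  e w c -> connect_in (nonnbrs v) c u ->
  exists X, [/\ hole (edge e) X, u \in X & w \in X].
Proof.
move=> vH unv evw wnu ewc ccu.
have [A [B [a [b [AB ant arcA arcB]]]]] := hole_arcs hH vH uH unv.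
have [[_ aA evA _] [_ bB evB _]] := (arcA, arcB).
have sH : {subset A :|: B <= H :\: [set v; u]} by rewrite AB.
have [aH bH] : a \in H :\: [set v; u] /\ b \in H :\: [set v; u].
  by split; apply: sH; rewrite in_setU ?aA ?bB ?orbT.
have cu : c != u by apply: contraTneq wnu => <-; rewrite inE e_sym ewc andbF.
have cN : c \in nonnbrs v :\ u.
  have := connect_in_mem ccu; rewrite (negbTE cu) => /andP[cv _].
  by rewrite in_setD1 cu.
set R := component (nonnbrs v :\ u) c.
have uR : attached u R.
  have [||r [y [_ + ery crR]]] := @connect_in_exit _ (~: [set u]) _ _ ccu.
  - by rewrite !inE.
  - by rewrite !inE eqxx.
  - rewrite !inE negbK => /andP[/eqP yu _]; apply/attachedP; exists r.
      by rewrite inE setDE.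
    by rewrite e_sym -yu.
have hole_along d D : arc v u d D -> D \subset A :|: B -> ~~ attached d R ->
    exists X, [/\ hole (edge e) X, u \in X & w \in X].
  move=> arcD /subsetP sD.
  apply: (hole_of_arc_component unv wnu evw ewc cN uR arcD).
  - by apply/negP => /sD/sH; rewrite !inE eqxx.
  - by apply/negP => /sD/sH; rewrite !inE eqxx orbT.
case: (boolP (attached a R)) => [aR|]; last first.
  by apply: hole_along arcA _; apply: subsetUl.
apply: hole_along arcB (subsetUr _ _) _.
apply: (NC_component_not_both_attached _ _ _ (ant _ _ aA bB) unv cN aR).
- by case/setDP: aH; case/setDP: bH.
- by rewrite evA.
- by rewrite evB.
Qed.

End NCVertex.

Lemma NC_hole_of_adjacent u u' w H H' :
  NC_vertex (edge e) u -> NC_vertex (edge e) u' ->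
  hole (edge e) H -> hole (edge e) H' ->
  u \in H -> w \in H -> u' \in H' -> w \in H' ->
  e u u' -> u \in nonnbrs w -> u' \in nonnbrs w ->
  exists X, [/\ hole (edge e) X, u \in X & u' \in X].
Proof.
move=> ncu ncu' hH hH' uH wH u'H' wH' euu' unw u'nw.
have u'u : u' != u by apply: contraTneq euu' => ->; rewrite e_irr.
have cwu := NC_connect_in_nonnbrs ncu hH uH wH unw u'nw u'u.
have cwu' : connect_in (u' |: nonnbrs u) w u'.
  apply: (NC_connect_in_nonnbrs ncu' hH' u'H' wH' u'nw unw).
  by rewrite eq_sym.
have [|a [+ eua cwa]] := connect_in_first_nbr cwu; first by rewrite nonnbrs_sym.
case/setU1P=> [au|anu']; first by rewrite au e_irr in eua.
have cau' : connect_in ([set a; u'] :|: nonnbrs u) a u'.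
  apply: (@connect_in_trans _ w).
    rewrite connect_in_sym; apply: connect_inS cwa; rewrite -setUA setUS //.
    by apply: (subset_trans (subsetIr _ _)); apply: subsetUr.
  by apply: connect_inS cwu'; rewrite -setUA subsetUr.
have u'na : u' \in nonnbrs a by rewrite nonnbrs_sym.
have [X [hX [_ uX u'X] _ _]] :=
  hole_closing_path cau' eua euu' u'na (subxx _).
by exists X.
Qed.

Lemma hole_second_nbr H u v : hole (edge e) H -> u \in H -> v \in H -> e v u ->
  exists w, [/\ w \in H, e v w & w \in nonnbrs u].
Proof.
move=> hH uH vH evu; have [a [b [aH bH bna evH]]] := hole_nbrs hH vH.
move: evu; rewrite evH // => /orP[]/eqP->.
  by exists b; rewrite evH // eqxx orbT.
by exists a; rewrite evH // eqxx nonnbrs_sym.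
Qed.

End Graph.

(** * Local chordalization *)

Lemma boolean_relation (T : Type) (adj : T -> T -> Prop) :
  exists e : rel T, adj = edge e.
Proof.
exists (fun x y => `[< adj x y >]).
by apply/funext => x; apply/funext => y; rewrite asboolE.
Qed.

Lemma eq_in_hole (T : finType) (e e' : rel T) (X : {set T}) :
  {in X &, e =2 e'} -> hole (edge e) X -> hole (edge e') X.
Proof.
move=> eq_e [s [[us s4 adjs] XE]]; exists s; split=> //; split=> // x y xs ys.
by rewrite -adjs // eq_e // XE inE.
Qed.

Section LocalChordalization.
Variables (T : finType) (e : rel T) (u : T).
Hypotheses (e_sym : symmetric e) (e_irr : irreflexive e).
Implicit Types (v w x y : T) (X H D : {set T}).

Definition chordalized : rel T :=
  fun x y => `[< local_chordalize (edge e) u x y >].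

Lemma edge_chordalized : edge chordalized = local_chordalize (edge e) u.
Proof. by apply/funext => x; apply/funext => y; rewrite asboolE. Qed.

Lemma chordalized_sym : symmetric chordalized.
Proof.
move=> x y; apply/asboolP/asboolP; rewrite /local_chordalize e_sym; tauto.
Qed.

Lemma chordalized_irr : irreflexive chordalized.
Proof.
move=> x; apply/asboolP; rewrite /local_chordalize e_irr.
by case=> [//|[[->]|[->]]][].
Qed.

Lemma chordalized_off x y : x != u -> y != u -> chordalized x y = e x y.
Proof.
move=> /eqP xu /eqP yu; apply/asboolP/idP; rewrite /local_chordalize; tauto.
Qed.

Lemma chordalized_center x : x != u -> chordalized u x <->
  e u x \/ exists H, [/\ hole (edge e) H, u \in H & x \in H].
Proof.
move=> /eqP xu; rewrite /chordalized asboolE /local_chordalize; tauto.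
Qed.

Lemma sub_chordalized : subrel e chordalized.
Proof. by move=> x y exy; apply/asboolP; left. Qed.

Lemma nonnbrs_chordalized x : nonnbrs chordalized x \subset nonnbrs e x.
Proof.
apply/subsetP => y; rewrite !inE => /andP[->]; apply: contra.
exact: sub_chordalized.
Qed.

Lemma connect_in_chordalized D x y : u \notin D ->
  connect_in chordalized D x y = connect_in e D x y.
Proof.
move=> uD; apply: eq_connect => z t; apply/and3P/and3P => -[zD tD];
  by rewrite chordalized_off ?(memPn uD).
Qed.

Hypothesis ncu : NC_vertex (edge e) u.

Lemma chordalized_connect_in_nonnbrs v x : x \in nonnbrs e v ->
  u \in nonnbrs e v -> x != u -> chordalized u x ->
  connect_in e (nonnbrs e v) x u.
Proof.
move=> xnv unv xu cux; case: (boolP (e u x)) => [eux|nux].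
  by apply: connect_in_edge; rewrite // e_sym.
case/(chordalized_center xu): cux => [|[H [hH uH xH]]].
  by rewrite (negbTE nux).
have unx : u \in nonnbrs e x by rewrite inE eq_sym xu e_sym.
have vnx : v \in nonnbrs e x by rewrite nonnbrs_sym.
have vu : v != u by move: unv; rewrite inE eq_sym => /andP[].
have := NC_connect_in_nonnbrs e_sym e_irr ncu hH uH xH unx vnx vu.
by rewrite (setUidPr _) ?sub1set.
Qed.

Lemma chordalized_hole_through_nbr H v w d D : hole (edge e) H ->
  u \in H -> v \in H -> u \in nonnbrs e v -> e v w ->
  w \in nonnbrs chordalized u -> arc chordalized w u d D -> u \notin D ->
  D \subset nonnbrs chordalized v ->
  exists X, [/\ hole (edge e) X, u \in X & w \in X].
Proof.
move=> hH uH vH unv evw wncu [cD dD cwD /attachedP[x xD cux]] uD sD.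
have wu : w != u by move: wncu; rewrite inE => /andP[].
have {}sD : D \subset nonnbrs e v := subset_trans sD (nonnbrs_chordalized v).
have ewd : e w d by rewrite -chordalized_off ?(memPn uD d dD) // cwD ?eqxx.
have cdx : connect_in e (nonnbrs e v) d x.
  by apply: connect_inS sD _; rewrite -connect_in_chordalized // cD.
have cxu : connect_in e (nonnbrs e v) x u.
  apply: chordalized_connect_in_nonnbrs cux => //; last exact: memPn xD.
  exact: (subsetP sD).
have wnu : w \in nonnbrs e u := subsetP (nonnbrs_chordalized u) w wncu.
apply: (NC_hole_through_nbr e_sym e_irr ncu hH uH vH unv evw wnu ewd).
exact: connect_in_trans cdx cxu.
Qed.

Lemma chordalized_hole_old_edge X v : hole (edge chordalized) X ->
  u \in X -> v \in X -> chordalized u v -> e u v.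
Proof.
move=> hX uX vX cuv; apply: contraT => nuv.
have vu : v != u by apply: contraTneq cuv => ->; rewrite chordalized_irr.
have unv : u \in nonnbrs e v by rewrite inE eq_sym vu e_sym.
have [H [hH uH vH]] : exists H, [/\ hole (edge e) H, u \in H & v \in H].
  by case/(chordalized_center vu): cuv => //; rewrite (negbTE nuv).
have cvu : chordalized v u by rewrite chordalized_sym.
have [w [wX cvw wncu]] :=
  hole_second_nbr chordalized_sym chordalized_irr hX uX vX cvu.
have /andP[wu ncuw] : (w != u) && ~~ chordalized u w by rewrite inE in wncu.
have evw : e v w by rewrite -chordalized_off.
have uncw : u \in nonnbrs chordalized w.
  by rewrite nonnbrs_sym //; apply: chordalized_sym.
have [A [B [a [b [AB ant arcA arcB]]]]] :=
  hole_arcs chordalized_sym chordalized_irr hX wX uX uncw.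
have no_arc d D : arc chordalized w u d D -> D \subset A :|: B ->
    ~ D \subset nonnbrs chordalized v.
  rewrite AB => arcD /subsetP sD sDv; case/negP: ncuw.
  apply/(chordalized_center wu); right.
  apply: (chordalized_hole_through_nbr hH uH vH unv evw wncu arcD _ sDv).
  by apply/negP => /sD; rewrite !inE eqxx orbT.
have vw : v != w by apply: contraTneq evw => ->; rewrite e_irr.
have : v \in A :|: B by rewrite AB !inE negb_or vw vu.
case/setUP=> [vA|vB].
  case: (no_arc _ _ arcB (subsetUr _ _)).
  by apply/subsetP => y; apply: ant.
case: (no_arc _ _ arcA (subsetUl _ _)).
by apply/subsetP => y /(anticomplete_sym chordalized_sym ant); apply.
Qed.

Lemma hole_chordalized X :
  hole (edge chordalized) X -> hole (edge e) X /\ u \notin X.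
Proof.
move=> hX; case: (boolP (u \in X)) => [uX|uX]; last first.
  split=> //; apply: eq_in_hole hX => x y xX yX.
  by rewrite chordalized_off ?(memPn uX).
have [a [b [aX _ _ cuX]]] := hole_nbrs chordalized_sym chordalized_irr hX uX.
have cua : chordalized a u by rewrite chordalized_sym cuX ?eqxx.
have [w [wX _]] :=
  hole_second_nbr chordalized_sym chordalized_irr hX uX aX cua.
rewrite inE => /andP[wu /negP[]].
apply/(chordalized_center wu); right; exists X; split=> //.
have center y : y \in X -> chordalized u y = e u y.
  move=> yX; apply/idP/idP; first exact: chordalized_hole_old_edge hX uX yX.
  exact: sub_chordalized.
apply: eq_in_hole hX => x y xX yX.
case: (eqVneq x u) => [->|xu]; first exact: center.
case: (eqVneq y u) => [->|yu]; last exact: chordalized_off.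
by rewrite chordalized_sym center // e_sym.
Qed.

Lemma NC_vertex_chordalized v :
  NC_vertex (edge e) v -> NC_vertex (edge chordalized) v.
Proof.
move=> ncv [H [H' [a [b [c [[hH hH' vH vH'] [[aH bH cH] [mH' [ac ab bc]]]]]]]]].
have [hHe uH] := hole_chordalized hH; have [hHe' _] := hole_chordalized hH'.
apply: ncv; exists H, H', a, b, c; do !split=> //.
  by rewrite -chordalized_off ?(memPn uH).
by rewrite -chordalized_off ?(memPn uH).
Qed.

End LocalChordalization.

Lemma hatG_edge (T : finType) (e : rel T) (s : seq T) x y :
  symmetric e -> irreflexive e -> {in s, forall u, NC_vertex (edge e) u} ->
  hatG (edge e) s x y ->
  e x y \/ exists H,
    [/\ hole (edge e) H, x \in H, y \in H & (x \in s) || (y \in s)].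
Proof.
elim: s e => [|u s IH] e e_sym e_irr nc /=; first by left.
have ncu := nc u (mem_head _ _).
rewrite -edge_chordalized => /IH[].
- exact: chordalized_sym.
- exact: chordalized_irr.
- move=> v vs; apply: NC_vertex_chordalized => //.
  by apply: nc; rewrite inE vs orbT.
- move/asboolP=> [|[]]; first by left.
    by case=> -> [_ [H [hH uH yH]]]; right; exists H; rewrite !inE eqxx.
  by case=> -> [_ [H [hH uH xH]]]; right; exists H; rewrite !inE eqxx orbT.
- case=> H [hH xH yH xys]; right; exists H; split=> //.
    by have [] := hole_chordalized e_sym e_irr ncu hH.
  by rewrite !inE; case/orP: xys => ->; rewrite !orbT.
Qed.

(** * Nonadjacent pairs in a clique of the chordalized graph *)

Section CliqueNonedges.
Variables (T : finType) (e : rel T) (C K : {set T}).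
Hypotheses (e_sym : symmetric e) (e_irr : irreflexive e).
Hypothesis NC_C : NC_set (edge e) C.
Hypothesis nonedge_hole : forall x y, x \in K -> y \in K -> y \in nonnbrs e x ->
  exists H, [/\ hole (edge e) H, x \in H, y \in H & (x \in C) || (y \in C)].
Implicit Types (u v w x y : T) (H : {set T}).

Lemma hole_NC_set_eq H u v : hole (edge e) H -> u \in H -> v \in H ->
  u \in C -> v \in C -> u = v.
Proof.
have [_ one] := NC_C; move=> /one/card_le1_eqP oneH uH vH uC vC.
by apply: oneH; rewrite inE ?uH ?vH.
Qed.

Lemma nonedge_NC_set_mem x y : x \in K -> y \in K -> y \in nonnbrs e x ->
  (x \in C) = (y \notin C).
Proof.
move=> xK yK ynx; have [H [hH xH yH]] := nonedge_hole xK yK ynx.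
have yx : y != x by move: ynx; rewrite inE => /andP[].
case: (boolP (y \in C)) => yC; last by rewrite orbF.
by move=> _; apply: contraNF yx => xC; rewrite (hole_NC_set_eq hH yH xH).
Qed.

Lemma edge_NC_set_mem_eq x y : x \in K -> y \in K -> x != y ->
  (x \in C) = (y \in C) -> e x y.
Proof.
move=> xK yK xy xyC; apply: contraT => nxy.
have ynx : y \in nonnbrs e x by rewrite inE eq_sym xy.
by have := nonedge_NC_set_mem xK yK ynx; rewrite xyC; case: (y \in C).
Qed.

Lemma NC_set_no_common_nonnbr u v w : u \in K -> v \in K -> w \in K ->
  u \in C -> v \in C -> u != v -> w \in nonnbrs e u -> w \notin nonnbrs e v.
Proof.
move=> uK vK wK uC vC uv wnu; apply/negP => wnv.
have [H [hH uH wH _]] := nonedge_hole uK wK wnu.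
have [H' [hH' vH' wH' _]] := nonedge_hole vK wK wnv.
have [ncC _] := NC_C.
have [|||X [hX uX vX]] := NC_hole_of_adjacent e_sym e_irr (ncC u uC) (ncC v vC)
  hH hH' uH wH vH' wH'.
- by apply: edge_NC_set_mem_eq; rewrite ?uC.
- by rewrite nonnbrs_sym.
- by rewrite nonnbrs_sym.
by case/eqP: uv; apply: hole_NC_set_eq hX uX vX uC vC.
Qed.

Lemma nonedge_NC_set_eq u v w w' : u \in K -> v \in K -> w \in K -> w' \in K ->
  u \in C -> v \in C -> w \in nonnbrs e u -> w' \in nonnbrs e v -> u = v.
Proof.
move=> uK vK wK w'K uC vC wnu w'nv; apply: contrapT => /eqP uv.
have vu : v != u by rewrite eq_sym.
have wC : w \notin C by rewrite -(nonedge_NC_set_mem uK wK wnu).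
have w'C : w' \notin C by rewrite -(nonedge_NC_set_mem vK w'K w'nv).
have edge_other p q x : p \in K -> q \in K -> x \in K -> p \in C -> q \in C ->
    p != q -> x \notin C -> x \in nonnbrs e p -> e q x.
  move=> pK qK xK pC qC pq xC xnp.
  have := NC_set_no_common_nonnbr pK qK xK pC qC pq xnp.
  by rewrite inE negb_and !negbK eq_sym (negbTE (memPn xC q qC)).
have evw : e v w by apply: edge_other wnu.
have euw' : e u w' by apply: edge_other w'nv.
have euv : e u v by apply: edge_NC_set_mem_eq; rewrite ?uC.
have ww' : w != w'.
  by apply: contraTneq w'nv => <-; rewrite inE evw andbF.
have eww' : e w w'.
  by apply: edge_NC_set_mem_eq; rewrite // (negbTE wC) (negbTE w'C).
pose P := [set v; w'] :|: [set w].
have cvw' : connect_in e P v w'.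
  by apply: (@connect_in_trans _ _ _ w); apply: connect_in_edge;
    rewrite // /P !inE eqxx ?orbT.
have sP : P \subset [set v; w'] :|: nonnbrs e u by rewrite setUS // sub1set.
have [X [hX [vX uX _] _ _]] :=
  hole_closing_path e_sym e_irr cvw' euv euw' w'nv sP.
by case/eqP: uv; apply: hole_NC_set_eq hX uX vX uC vC.
Qed.

Lemma clique_setD1_NC_set u w : u \in K -> w \in K -> u \in C ->
  w \in nonnbrs e u -> clique (edge e) (K :\ u).
Proof.
move=> uK wK uC wnu x y /setD1P[xu xK] /setD1P[yu yK] /eqP xy.
apply: contraT => nxy.
have ynx : y \in nonnbrs e x by rewrite inE eq_sym xy.
have := nonedge_NC_set_mem xK yK ynx; case: (boolP (x \in C)) => xC.
  by move=> _; rewrite (nonedge_NC_set_eq xK uK yK wK xC uC ynx wnu) eqxx in xu.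
move/esym/negbFE => yC; move: yu.
rewrite (nonedge_NC_set_eq yK uK xK wK yC uC _ wnu) ?eqxx //.
by rewrite nonnbrs_sym.
Qed.

End CliqueNonedges.

Theorem theorem2p6 (T : finType) (adj : T -> T -> Prop)
  (adj_sym : forall x y, adj x y -> adj y x)
  (adj_irr : forall x, ~ adj x x)
  (C : {set T}) (HC : hole_cover adj C) (HNC : NC_set adj C)
  (s : seq T) (s_uniq : uniq s) (s_C : [set x in s] = C)
  (K : {set T}) (HK : clique (hatG adj s) K) (HnK : ~ clique adj K) :
  exists u, u \in K :&: C /\ clique adj (K :\ u).
Proof.
have [e adjE] := boolean_relation adj; subst adj.
have e_sym : symmetric e by move=> x y; apply/idP/idP; apply: adj_sym.
have e_irr : irreflexive e by move=> x; apply/negP/adj_irr.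
have sC x : (x \in s) = (x \in C) by rewrite -s_C inE.
have ncs : {in s, forall u, NC_vertex (edge e) u}.
  by move=> u; rewrite sC; case: HNC => + _; apply.
have nonedge_hole x y : x \in K -> y \in K -> y \in nonnbrs e x ->
    exists H, [/\ hole (edge e) H, x \in H, y \in H & (x \in C) || (y \in C)].
  move=> xK yK; rewrite inE -!sC => /andP[/eqP yx /negP nxy].
  by have [//|] := hatG_edge e_sym e_irr ncs (HK x y xK yK (nesym yx)).
have [x [y [xK yK ynx]]] :
    exists x y, [/\ x \in K, y \in K & y \in nonnbrs e x].
  apply: contrapT => no_nonedge; apply: HnK => x y xK yK /eqP xy.
  apply: contraT => nxy; case: no_nonedge.
  by exists x, y; rewrite inE eq_sym xy.
have remove := clique_setD1_NC_set e_sym e_irr HNC nonedge_hole.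
have [H [_ _ _ /orP[xC|yC]]] := nonedge_hole x y xK yK ynx.
  by exists x; rewrite inE xK xC; split=> //; apply: remove xK yK xC ynx.
exists y; rewrite inE yK yC; split=> //; apply: remove yK xK yC _.
by rewrite nonnbrs_sym.
Qed.
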